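(* Let $b\ge 2$ be an integer. If either $d = 2b-1$ and $G$ is the hyperbanana $H_{d,b}$, or $d = 2b$ and $G$ is an even hyperbanana $H^+_{d,b}$, then $G$ is flexible in $\mathbb{R}^d$; that is, generic frameworks $(G,\mathbf p)$ in $\mathbb{R}^d$ are (infinitesimally) flexible.
   Context: All graphs are finite and simple. Framework and rigidity matrix: a (bar-and-joint) framework $F=(G,\mathbf p)$ in $\mathbb{R}^d$ is a graph $G=(V,E)$ with $V=\{v_1,\dots,v_n\}$, $|E|=m$, together with a map $\mathbf p: V\to\mathbb{R}^d$, $v_i\mapsto \mathbf p_i$. Its rigidity matrix $M_F$ is the $m\times dn$ real matrix whose columns are grouped into $n$ blocks of $d$ columns, one block per vertex; the row of an edge $v_iv_j$ has $\mathbf p_i-\mathbf p_j$ in the block of $v_i$, $\mathbf p_j-\mathbf p_i$ in the block of $v_j$, and zeros elsewhere. Rigid/flexible: $F$ is (infinitesimally) rigid if inserting any new bar (edge) between vertices does not change the rank of $M_F$; otherwise it is (infinitesimally) flexible. Generic: $(G,\mathbf p)$ is generic if the rank of its rigidity matrix is maximal among all frameworks $(G,\mathbf q)$ in $\mathbb{R}^d$. Banana bunch: $B_{d,b}$ is the graph obtained from a complete graph $K_d$ on $d$ vertices by adding $b$ new vertices (the banana vertices), each joined to all $d$ vertices of the $K_d$; there are no edges between banana vertices. Hyperbanana: $H_{d,b}$ is obtained from two copies of $B_{d,b}$ by identifying their banana vertices via a fixed bijection. Explicitly, its vertex set is a disjoint union $V = V_1\cup V_2\cup U$ with $|V_1|=|V_2|=d$,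 $|U|=b$; its edges are all pairs inside $V_1$, all pairs inside $V_2$, and all pairs consisting of one vertex of $U$ and one vertex of $V_1\cup V_2$. Even hyperbanana: for even $d$, $H^+_{d,b}$ is the graph consisting of $H_{d,b}$ together with $\frac d2$ additional edges, each joining a vertex of $V_1$ to a vertex of $V_2$, with pairwise distinct endpoints (i.e. the additional edges form a matching between $V_1$ and $V_2$). *)

(* Defs.v *)
From HB Require Import structures.
From mathcomp Require Import all_boot all_order all_algebra.
From mathcomp Require Import reals.

Set Implicit Arguments.
Unset Strict Implicit.
Unset Printing Implicit Defensive.

Import Order.TTheory GRing.Theory Num.Theory.
Local Open Scope ring_scope.

Record sgraph (n : nat) := SGraph {
  adj :> rel 'I_n;
  adj_sym : symmetric adj;
  adj_irr : irreflexive adj }.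

(* Each edge is listed once, as an increasing pair of vertices. *)
Definition edges n (G : sgraph n) : {set 'I_n * 'I_n} :=
  [set e : 'I_n * 'I_n | (e.1 < e.2)%N && G e.1 e.2].

Section AddEdge.
Variables (n : nat) (G : sgraph n) (u v : 'I_n).

(* The guard [x != y] makes this a simple graph (namely G) also when u = v. *)
Definition add_edge_rel : rel 'I_n := fun x y =>
  (x != y) &&
  [|| G x y, (x == u) && (y == v) | (x == v) && (y == u)].

Lemma add_edge_sym : symmetric add_edge_rel.
Proof.
move=> x y; rewrite /add_edge_rel eq_sym adj_sym; congr (_ && (_ || _)).
by rewrite orbC andbC; congr (_ || _); rewrite andbC.
Qed.

Lemma add_edge_irr : irreflexive add_edge_rel.
Proof. by move=> x; rewrite /add_edge_rel eqxx. Qed.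

Definition add_edge : sgraph n := SGraph add_edge_sym add_edge_irr.
End AddEdge.

Section Rigidity.
Variables (R : realType) (n d : nat).

(* Row [w] of this matrix is the block of [d] columns of the vertex [w]; [mxvec]
   below concatenates the blocks. *)
Definition bar_row (p : 'I_n -> 'rV[R]_d) (i j : 'I_n) : 'M[R]_(n, d) :=
  \matrix_(w < n) if w == i then p i - p j
                  else if w == j then p j - p i
                  else 0.

Definition rigidity_mx (G : sgraph n) (p : 'I_n -> 'rV[R]_d) :
    'M[R]_(#|edges G|, n * d) :=
  \matrix_(k < #|edges G|) mxvec (bar_row p (enum_val k).1 (enum_val k).2).

Definition inf_rigid (G : sgraph n) (p : 'I_n -> 'rV[R]_d) : Prop :=
  forall u v : 'I_n, u != v ->
    \rank (rigidity_mx (add_edge G u v) p) = \rank (rigidity_mx G p).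

Definition inf_flexible (G : sgraph n) (p : 'I_n -> 'rV[R]_d) : Prop :=
  ~ inf_rigid G p.

Definition generic (G : sgraph n) (p : 'I_n -> 'rV[R]_d) : Prop :=
  forall q : 'I_n -> 'rV[R]_d,
    (\rank (rigidity_mx G q) <= \rank (rigidity_mx G p))%N.
End Rigidity.

Definition generically_flexible (R : realType) n (d : nat) (G : sgraph n) :
    Prop :=
  forall p : 'I_n -> 'rV[R]_d, generic G p -> inf_flexible G p.

Section Hyperbanana.
Variables (d b n : nat).

Definition hyperbanana_parts (V1 V2 U : {set 'I_n}) : Prop :=
  [/\ V1 :|: V2 :|: U = [set: 'I_n],
      [/\ [disjoint V1 & V2], [disjoint V1 & U] & [disjoint V2 & U]]
    & [/\ #|V1| = d, #|V2| = d & #|U| = b]].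

Definition hyperbanana_rel (V1 V2 U : {set 'I_n}) : rel 'I_n := fun x y =>
  (x != y) &&
  [|| (x \in V1) && (y \in V1),
      (x \in V2) && (y \in V2),
      (x \in U) && (y \in V1 :|: V2)
    | (y \in U) && (x \in V1 :|: V2)].

Definition is_hyperbanana (G : sgraph n) : Prop :=
  exists V1 V2 U : {set 'I_n},
    hyperbanana_parts V1 V2 U /\ (forall x y, G x y = hyperbanana_rel V1 V2 U x y).

Definition is_matching_between (V1 V2 : {set 'I_n}) (M : {set 'I_n * 'I_n}) :
    Prop :=
  [/\ M \subset setX V1 V2,
      {in M &, injective (fun e => e.1)}
    & {in M &, injective (fun e => e.2)}].

Definition is_even_hyperbanana (G : sgraph n) : Prop :=
  ~~ odd d /\
  exists (V1 V2 U : {set 'I_n}) (M : {set 'I_n * 'I_n}),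
    [/\ hyperbanana_parts V1 V2 U,
        is_matching_between V1 V2 M,
        #|M| = d./2
      & forall x y, G x y =
          [|| hyperbanana_rel V1 V2 U x y, (x, y) \in M | (y, x) \in M]].
End Hyperbanana.

(* Main.v *)
Require Import Defs.
From mathcomp Require Import all_boot all_order all_algebra.
From mathcomp Require Import reals.
From mathcomp Require Import ring zify.

(** A hyperbanana consists of two bodies, spanned by [V1 :|: U] and
    [V2 :|: U], that share only the banana vertices [U]; the [#|U| = b] shared
    joints lie in an affine subspace of dimension at most [b - 1], which acts
    as a hinge.  An infinitesimal rotation of the second body about this hinge,
    with the first body held still, preserves the length of every bar inside
    either body.  For [d = 2b - 1] the directions orthogonal to the hinge have
    dimension at least [b >= 2], so nonzero rotations exist.  For [d = 2b] they
    have dimension at least [b + 1], and there are enough of them to satisfy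
    the [b] linear conditions imposed by the matching bars as well.  A rotation
    in the plane of two directions [a] and [c] suffices: choosing [a]
    orthogonal to both ends of one matching bar makes the condition of that bar
    trivial and leaves room for [c] ([exists_hinge_rotation]).

    What needs care is that genericity only means maximal rank, so that joints
    may be in special position and the rotation might be a motion of the whole
    framework.  Suppose that a generic framework is rigid.

    First, its joints do not all lie in a hyperplane ([generic_not_flat]).  A
    clique of more than [d] vertices in a hyperplane orthogonal to [a] has an
    affine dependency [l], and [l i * l j] on the edge [ij] is a self-stress;
    moving one joint with nonzero [l] along [a] destroys this self-stress and
    creates no other, so that the rank would increase.

    Secondly, no vertex has all its neighbours in a hyperplane through it
    ([inf_rigid_nbhd_span]): moving that vertex alone along the normal would be
    a motion, hence by rigidity would preserve all distances, and the whole
    framework would be flat.  Applied to an unmatched vertex of [V1] and to one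
    of [V2], this shows that both bodies affinely span the space.

    Finally the hinge rotation is a motion, hence by rigidity preserves the
    distances between the two bodies ([hinged_bodies_flexible]).  This makes
    the velocity of each vertex of [V2] orthogonal to the first body, which
    spans, so this velocity vanishes; then [a] is orthogonal to the second
    body, which spans too, and [a = 0], a contradiction. *)

Set Implicit Arguments.
Unset Strict Implicit.
Unset Printing Implicit Defensive.

Import Order.TTheory GRing.Theory Num.Theory.
Local Open Scope ring_scope.

(** * Euclidean inner product and orthogonality *)

Section Dot.
Variables (R : realFieldType) (d : nat).
Implicit Types (u v w : 'rV[R]_d).

Definition dot u v : R := (u *m v^T) 0 0.

Lemma dotC u v : dot u v = dot v u.
Proof. by rewrite /dot -[u *m _]trmxK trmx_mul trmxK mxE. Qed.

Lemma dotDl u v w : dot (u + v) w = dot u w + dot v w.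
Proof. by rewrite /dot mulmxDl mxE. Qed.

Lemma dotZl k u v : dot (k *: u) v = k * dot u v.
Proof. by rewrite /dot -scalemxAl mxE. Qed.

Lemma dotDr u v w : dot u (v + w) = dot u v + dot u w.
Proof. by rewrite dotC dotDl !(dotC u). Qed.

Lemma dotZr k u v : dot u (k *: v) = k * dot u v.
Proof. by rewrite dotC dotZl (dotC u). Qed.

Lemma dotNl u v : dot (- u) v = - dot u v.
Proof. by rewrite -scaleN1r dotZl mulN1r. Qed.

Lemma dotNr u v : dot u (- v) = - dot u v.
Proof. by rewrite dotC dotNl dotC. Qed.

Lemma dot0l v : dot 0 v = 0.
Proof. by rewrite /dot mul0mx mxE. Qed.

Lemma dot0r v : dot v 0 = 0.
Proof. by rewrite dotC dot0l. Qed.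

Definition dotE := (dotDl, dotDr, dotNl, dotNr, dotZl, dotZr, dot0l, dot0r).

Lemma dot_suml (I : finType) (f : I -> 'rV[R]_d) v :
  dot (\sum_i f i) v = \sum_i dot (f i) v.
Proof. by rewrite /dot mulmx_suml summxE. Qed.

Lemma dot_sumr (I : finType) (f : I -> 'rV[R]_d) v :
  dot v (\sum_i f i) = \sum_i dot v (f i).
Proof. by rewrite dotC dot_suml; apply: eq_bigr => i _; rewrite dotC. Qed.

Lemma dotvv_eq0 v : (dot v v == 0) = (v == 0).
Proof.
apply/eqP/eqP => [|->]; last by rewrite dot0l.
rewrite /dot mxE => vv0; apply/rowP => j; apply/eqP.
have sq_ge0 i : true -> 0 <= v 0 i * v^T i 0 by rewrite mxE -expr2 sqr_ge0.
have /eqP : v 0 j * v^T j 0 = 0 by apply: (psumr_eq0P sq_ge0 vv0).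
by rewrite !mxE mulf_eq0 orbb.
Qed.

Lemma exists_orthogonal (s : seq 'rV[R]_d) : (size s < d)%N ->
  exists2 a, a != 0 & forall v, v \in s -> dot a v = 0.
Proof.
move=> ltsd; pose A := \matrix_(i < size s) s`_i.
have : kermx A^T != 0.
  by rewrite -mxrank_eq0 mxrank_ker mxrank_tr -lt0n subn_gt0
             (leq_ltn_trans (rank_leq_row A)).
case/rowV0Pn=> a /sub_kermxP aA a_neq0; exists a => // v /(nthP 0) [i lti <-].
have /matrixP/(_ 0 (Ordinal lti)) := aA; rewrite [RHS]mxE => <-.
by rewrite /dot !mxE; apply: eq_bigr => j _; rewrite !mxE.
Qed.

(** Two directions that span the plane of a rotation fixing the vectors of [s].
    The pairs in [N] are the ends of the bars between the two bodies: the
    skew form of the rotation, a 2 by 2 minor, has to vanish on each of them.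
    Taking [a] orthogonal to both members of the first pair saves one
    condition on [c]; once [a] is fixed all conditions on [c] are linear.
    Requiring [c] orthogonal to [a] is a convenient way to make them
    independent. *)
Lemma exists_hinge_rotation (s : seq 'rV[R]_d) (N : seq ('rV[R]_d * 'rV[R]_d)) :
    (size s + size N < d)%N -> (size s + 1 < d)%N ->
    N = [::] \/ (size s + 2 < d)%N ->
  exists a c : 'rV[R]_d,
    [/\ [/\ a != 0, c != 0 & dot a c = 0],
        forall v, v \in s -> dot a v = 0, forall v, v \in s -> dot c v = 0
      & forall e, e \in N -> dot a e.1 * dot c e.2 = dot c e.1 * dot a e.2].
Proof.
case: N => [|e N] /= lt_sN lt_s1.
  have [|a a0 aP] := @exists_orthogonal s; first by rewrite addn0 in lt_sN.
  move=> _; have [|c c0 cP] := @exists_orthogonal (a :: s).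
    by rewrite /= -addn1.
  exists a, c; split=> // [|v vs].
    by split=> //; rewrite dotC cP ?mem_head.
  by apply: cP; rewrite inE vs orbT.
case=> // lt_s2.
have [|a a0 aP] := @exists_orthogonal [:: e.1, e.2 & s].
  by rewrite /= -addn2.
pose f (g : 'rV[R]_d * 'rV[R]_d) := dot a g.1 *: g.2 - dot a g.2 *: g.1.
have [|c c0 cP] := @exists_orthogonal (a :: map f N ++ s).
  by rewrite /= size_cat size_map addnC -addnS.
exists a, c; split=> // [|v vs|v vs|g].
- by split=> //; rewrite dotC cP ?mem_head.
- by apply: aP; rewrite !inE vs !orbT.
- by apply: cP; rewrite !(inE, mem_cat) vs !orbT.
rewrite inE => /predU1P[->|gN]; first by rewrite !aP ?inE ?eqxx ?orbT // mulr0 mul0r.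
have := cP (f g); rewrite inE mem_cat map_f // orbT => /(_ isT).
rewrite /f dotDr dotNr !dotZr => /eqP; rewrite subr_eq0 [_ * dot c g.1]mulrC.
by move/eqP.
Qed.
End Dot.

(** The vectors [(1, p i)] are all orthogonal to the nonzero vector
    [(- dot (p c) a, a)], so they span at most [d] dimensions and more than [d]
    of them are linearly dependent. *)
Lemma affine_dependence (R : realFieldType) (I : finType) (d : nat)
    (C : {set I}) (p : I -> 'rV[R]_d) (a : 'rV[R]_d) :
    (d < #|C|)%N -> a != 0 ->
    (forall i j, i \in C -> j \in C -> dot (p i - p j) a = 0) ->
  exists l : I -> R,
    [/\ forall i, i \notin C -> l i = 0, exists k, l k != 0,
        \sum_i l i = 0 & \sum_i l i *: p i = 0].
Proof.
move=> ltdC a_neq0 flat.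
have /card_gt0P[c cC] : (0 < #|C|)%N by apply: leq_ltn_trans ltdC.
pose B := \matrix_(k < #|C|) row_mx (1%:M : 'M[R]_1) (p (enum_val k)).
pose w := row_mx (- dot (p c) a)%:M a.
have Bw : B *m w^T = 0.
  apply/row_matrixP => k; rewrite row0 row_mul rowK /w tr_row_mx mul_row_col.
  rewrite mul1mx tr_scalar_mx; apply/rowP => i; rewrite ord1 !mxE.
  have /eqP := flat _ c (enum_valP k) cC; rewrite dotDl dotNl subr_eq0 => /eqP pkc.
  by rewrite eqxx mulr1n -pkc /dot !mxE addNr.
have w_neq0 : w != 0.
  by apply: contra_neq a_neq0; rewrite -row_mx0 => /eq_row_mx[].
have : kermx B != 0.
  rewrite -mxrank_eq0 mxrank_ker -lt0n subn_gt0 (leq_ltn_trans _ ltdC) //.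
  have := mulmx0_rank_max Bw; rewrite mxrank_tr rank_rV w_neq0.
  by rewrite addnC leq_add2l.
case/rowV0Pn=> u /sub_kermxP uB u_neq0.
(* The coefficients of the dependency, extended by zero outside of [C]: the
   sum has at most one term. *)
pose l i : R := \sum_(k | enum_val k == i) u 0 k.
have lE k : l (enum_val k) = u 0 k.
  rewrite /l (eq_bigl (pred1 k)) ?big_pred1_eq // => k'.
  by rewrite (inj_eq enum_val_inj).
have sum_l (V : lmodType R) (f : I -> V) :
    \sum_i l i *: f i = \sum_k u 0 k *: f (enum_val k).
  rewrite (partition_big enum_val predT) //=; apply: eq_bigr => i _.
  by rewrite scaler_suml; apply: eq_bigr => k /eqP ->.
have uB2 : \sum_k u 0 k *: row k B = 0 by rewrite -mulmx_sum_row.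
exists l; split.
- move=> i iC; rewrite /l big_pred0 // => k; apply: contraNF iC => /eqP <-.
  exact: enum_valP.
- have /rV0Pn[k uk] := u_neq0; exists (enum_val k); by rewrite lE.
- rewrite [LHS](_ : _ = \sum_k u 0 k); last first.
    by rewrite [RHS](partition_big enum_val predT).
  have /rowP/(_ (lshift d 0)) := uB2; rewrite [RHS]mxE summxE => B0.
  rewrite -[RHS]B0; apply: eq_bigr => k _.
  by rewrite rowK mxE row_mxEl mxE mulr1.
- rewrite sum_l; apply/rowP => j; rewrite [RHS]mxE.
  have /rowP/(_ (rshift 1 j)) := uB2; rewrite [RHS]mxE summxE => B0.
  rewrite -[RHS]B0 summxE; apply: eq_bigr => k _.
  by rewrite rowK [LHS]mxE [RHS]mxE row_mxEr.
Qed.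

(** * Motions and stresses of a framework *)

Section Framework.
Variables (R : realType) (n d : nat).
Implicit Types (G : sgraph n) (p q x : 'I_n -> 'rV[R]_d) (a : 'rV[R]_d).

Definition inf_motion G p x : Prop :=
  forall i j, G i j -> dot (p i - p j) (x i - x j) = 0.

Definition vec x : 'rV[R]_(n * d) := mxvec (\matrix_i x i).

Lemma vecP (v : 'rV[R]_(n * d)) : v = vec (fun i => row i (vec_mx v)).
Proof.
rewrite /vec -[LHS]vec_mxK; congr mxvec; apply/row_matrixP => i.
by rewrite rowK.
Qed.

Lemma bar_row_vec p x i j : i != j ->
  mxvec (bar_row p i j) *m (vec x)^T = (dot (p i - p j) (x i - x j))%:M.
Proof.
move=> neq_ij.
(* The matrix of a bar is the outer product of the incidence vector of the
   edge with the direction of the bar. *)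
have -> : bar_row p i j = (delta_mx 0 i - delta_mx 0 j)^T *m (p i - p j).
  apply/row_matrixP => w; rewrite rowK row_mul.
  have -> : row w (delta_mx (0 : 'I_1) i - delta_mx 0 j : 'rV[R]_n)^T
            = ((w == i)%:R - (w == j)%:R)%:M.
    by apply/rowP => k; rewrite !ord1 !mxE !eqxx.
  rewrite mul_scalar_mx; case: (eqVneq w i) => [->|_].
    by rewrite (negPf neq_ij) subr0 scale1r.
  by case: eqP => _; rewrite ?subrr ?scale0r // sub0r scaleN1r opprB.
rewrite mxvec_dotmul mulmxBl -!rowE !rowK.
by rewrite dotC /dot; apply/matrixP => r s; rewrite !ord1 [RHS]mxE eqxx mulr1n.
Qed.

Lemma edges_neq G (e : 'I_n * 'I_n) : e \in edges G -> e.1 != e.2.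
Proof. by rewrite inE => /andP[+ _]; apply: contraTneq => ->; rewrite ltnn. Qed.

Lemma rigidity_mx_vec G p x (k : 'I_#|edges G|) :
  (rigidity_mx G p *m (vec x)^T) k 0 =
  dot (p (enum_val k).1 - p (enum_val k).2) (x (enum_val k).1 - x (enum_val k).2).
Proof.
have -> A (B : 'cV[R]_(n * d)) : (A *m B) k 0 = (row k A *m B) 0 0 :> R.
  by rewrite -row_mul [RHS]mxE.
by rewrite rowK (bar_row_vec _ _ (edges_neq (enum_valP k))) mxE eqxx mulr1n.
Qed.

Lemma inf_motionP G p x :
  inf_motion G p x <-> rigidity_mx G p *m (vec x)^T = 0.
Proof.
split=> [mx | /matrixP Mx i j Gij].
  apply/matrixP => k c; rewrite ord1 rigidity_mx_vec mxE; apply: mx.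
  by have := enum_valP k; rewrite inE => /andP[].
have eq0 e : e \in edges G -> dot (p e.1 - p e.2) (x e.1 - x e.2) = 0.
  move=> eG; have := Mx (enum_rank_in eG e) 0.
  by rewrite rigidity_mx_vec mxE enum_rankK_in.
case: (ltngtP i j) => [ij|ji|/val_inj eq_ij].
- by apply: (eq0 (i, j)); rewrite inE ij.
- rewrite -opprB dotNl -(opprB (x j)) dotNr opprK.
  by apply: (eq0 (j, i)); rewrite inE ji adj_sym.
- by rewrite eq_ij subrr dot0l.
Qed.

(** Rigidity puts the row of any further bar in the row space of the rigidity
    matrix, and a motion is orthogonal to that row space. *)
Lemma inf_rigid_motion G p x : inf_rigid G p -> inf_motion G p x ->
  forall i j, dot (p i - p j) (x i - x j) = 0.
Proof.
move=> rigid /inf_motionP Mx i j.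
have [->|neq_ij] := eqVneq i j; first by rewrite subrr dot0l.
suff /inf_motionP mx : rigidity_mx (add_edge G i j) p *m (vec x)^T = 0.
  by apply: mx; rewrite /= /add_edge_rel neq_ij !eqxx orbT.
have sub : (rigidity_mx G p <= rigidity_mx (add_edge G i j) p)%MS.
  apply/row_subP => k; have := enum_valP k; set e := enum_val k => eG.
  have eG' : e \in edges (add_edge G i j).
    move: (eG); rewrite !inE /= /add_edge_rel => /andP[-> ->] /=.
    by rewrite andbT (edges_neq eG).
  have -> : row k (rigidity_mx G p) =
      row (enum_rank_in eG' e) (rigidity_mx (add_edge G i j) p).
    by rewrite !rowK enum_rankK_in.
  exact: row_sub.
have := mxrank_leqif_eq sub; rewrite -(rigid _ _ neq_ij) => /leqif_refl.
by case/andP=> _ /submxP[D ->]; rewrite -mulmxA Mx mulmx0.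
Qed.

Lemma stress_work G p x (w : 'rV_#|edges G|) :
  (w *m rigidity_mx G p *m (vec x)^T) 0 0 =
  \sum_k w 0 k * dot (p (enum_val k).1 - p (enum_val k).2)
                     (x (enum_val k).1 - x (enum_val k).2).
Proof.
by rewrite -mulmxA mxE; apply: eq_bigr => k _; rewrite rigidity_mx_vec.
Qed.

(** The principle of virtual work: a load is zero as soon as it does no work
    under any displacement. *)
Lemma stressP G p (w : 'rV_#|edges G|) :
  (forall x, (w *m rigidity_mx G p *m (vec x)^T) 0 0 = 0) ->
  w *m rigidity_mx G p = 0.
Proof.
by move=> w0; apply/eqP; rewrite -dotvv_eq0 {2}[w *m _]vecP /dot w0.
Qed.

(** When [l] is an affine dependency of the joints of a clique, this is the
    classical self-stress of that clique, as [product_stress_work] shows. *)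
Definition product_stress G (l : 'I_n -> R) : 'rV[R]_#|edges G| :=
  \row_k (l (enum_val k).1 * l (enum_val k).2).

(** Since [l] is supported on a clique, the sum over the edges is half the sum
    over all ordered pairs [(i, j)] of [l i * l j] times the inner product of
    the differences; expanding it, the diagonal terms [dot (p i) (x i)] come
    with a factor [\sum_j l j = 0] and only the cross terms remain.  The bars
    do no work on any displacement when [l] is a dependency of [p]. *)
Lemma product_stress_work G p x (l : 'I_n -> R) :
    (forall i j, i != j -> l i != 0 -> l j != 0 -> G i j) ->
    \sum_i l i = 0 ->
  (product_stress G l *m rigidity_mx G p *m (vec x)^T) 0 0 =
  - dot (\sum_i l i *: p i) (\sum_i l i *: x i).
Proof.
move=> clique suml; rewrite stress_work.
pose F (e : 'I_n * 'I_n) := l e.1 * l e.2 * dot (p e.1 - p e.2) (x e.1 - x e.2).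
under eq_bigr => k _ do rewrite mxE -/(F (enum_val k)).
rewrite -big_enum_val /=.
have -> : \sum_(e in edges G) F e = \sum_(e : 'I_n * 'I_n | (e.1 < e.2)%N) F e.
  rewrite [RHS](bigID (mem (edges G))) /= [X in _ = _ + X]big1 ?addr0.
    by apply: eq_bigl => e; rewrite inE andbA andbb.
  move=> e /andP[lt_e]; rewrite inE lt_e /= /F => nG.
  have [->|l1] := eqVneq (l e.1) 0; first by rewrite !mul0r.
  have [->|l2] := eqVneq (l e.2) 0; first by rewrite mulr0 mul0r.
  by rewrite clique // in nG; apply: contraTneq lt_e => ->; rewrite ltnn.
have Fswap e : F (e.2, e.1) = F e.
  by rewrite /F /= !dotE; ring.
have gtE : \sum_(e : 'I_n * 'I_n | (e.2 < e.1)%N) F e =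
           \sum_(e : 'I_n * 'I_n | (e.1 < e.2)%N) F e.
  rewrite (reindex_inj (h := fun e => (e.2, e.1))) /=.
    by apply: eq_bigr => e _; rewrite Fswap.
  by move=> [a b] [a' b'] [-> ->].
have allE : \sum_e F e = 2 * \sum_(e : 'I_n * 'I_n | (e.1 < e.2)%N) F e.
  rewrite (bigID (fun e : 'I_n * 'I_n => (e.1 < e.2)%N)) /= mulr2n mulrDl mul1r.
  congr (_ + _); rewrite -[RHS]gtE (bigID (fun e : 'I_n * 'I_n => (e.2 < e.1)%N)) /=.
  rewrite [X in _ + X]big1 ?addr0 => [|e].
    by apply: eq_bigl => e; case: ltngtP.
  rewrite -!leqNgt => /andP[le21 le12].
  have e12 : e.1 = e.2 by apply/val_inj/eqP; rewrite eqn_leq le12.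
  by rewrite /F e12 subrr dot0l mulr0.
have : \sum_e F e = - 2 * dot (\sum_i l i *: p i) (\sum_i l i *: x i).
  rewrite -(pair_bigA _ (fun i j => F (i, j))) /=.
  pose s := \sum_i l i * dot (p i) (x i).
  have -> : \sum_i \sum_j F (i, j) = \sum_i (l i * dot (p i) (x i) * (\sum_j l j)
     + l i * s - l i * dot (p i) (\sum_j l j *: x j)
     - l i * dot (x i) (\sum_j l j *: p j)).
    apply: eq_bigr => i _; rewrite !dot_sumr !mulr_sumr -!sumrN -!big_split /=.
    by apply: eq_bigr => j _; rewrite /F /= !dotE (dotC (p j) (x i)); ring.
  have dot_lin f v : \sum_i l i * dot (f i) v = dot (\sum_i l i *: f i) v :> R.
    by rewrite dot_suml; apply: eq_bigr => i _; rewrite dotZl.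
  rewrite suml !sumrB big_split /= -!mulr_suml mulr0 suml mul0r !dot_lin.
  by rewrite (dotC (\sum_i l i *: x i)); ring.
have two_neq0 : (2 : R) != 0 by rewrite pnatr_eq0.
by rewrite allE mulNr -mulrN => /(mulfI two_neq0).
Qed.

(** * Hyperplanes containing joints *)

(** If all joints lay in a hyperplane orthogonal to [a], the rank could be
    increased by moving one joint [k] along [a].  Every self-stress of the new
    framework is one of the old: against displacements orthogonal to [a] both
    frameworks do the same work, and the flat one does no work against those
    along [a].  But the self-stress of a dependent clique is lost, because it
    now does work on the velocity of [k] along [a]. *)
Lemma generic_not_flat G p (C : {set 'I_n}) a :
    generic G p -> (d < #|C|)%N ->
    {in C &, forall i j, i != j -> G i j} ->
    (forall i j, dot (p i - p j) a = 0) ->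
  a = 0.
Proof.
move=> gen ltdC clique flat; apply/eqP; apply/negPn/negP => a_neq0.
have [l [lC [k lk] suml sumlp]] :=
  affine_dependence ltdC a_neq0 (fun i j _ _ => flat i j).
have cl i j : i != j -> l i != 0 -> l j != 0 -> G i j.
  by move=> neq_ij li lj; apply: clique neq_ij;
     [apply: contraNT li | apply: contraNT lj] => /lC ->.
pose bump i : 'rV[R]_d := (i == k)%:R *: a.
pose p' i := p i + bump i.
have sumlb : \sum_i l i *: bump i = l k *: a.
  rewrite (bigD1 k) //= /bump eqxx scale1r big1 ?addr0 // => i /negPf ->.
  by rewrite scale0r scaler0.
pose w := product_stress G l.
have wp : w *m rigidity_mx G p = 0.
  by apply: stressP => x; rewrite product_stress_work // sumlp dot0l oppr0.
have wp' : w *m rigidity_mx G p' != 0.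
  apply/eqP => wp'.
  have := product_stress_work p' bump cl suml; rewrite -/w wp' mul0mx mxE.
  have -> : \sum_i l i *: p' i = l k *: a.
    by under eq_bigr do rewrite scalerDr; rewrite big_split /= sumlp add0r.
  move/eqP; rewrite sumlb dotZl dotZr eq_sym oppr_eq0 !mulf_eq0 (negPf lk) /=.
  by rewrite dotvv_eq0 (negPf a_neq0).
have stress_sub (v : 'rV_#|edges G|) :
    v *m rigidity_mx G p' = 0 -> v *m rigidity_mx G p = 0.
  move=> vp'; apply: stressP => x.
  (* the projection of the displacement on the hyperplane *)
  pose y i := x i - (dot (x i) a / dot a a) *: a.
  have ya i : dot a (y i) = 0.
    by rewrite /y !dotE (dotC a (x i)) mulfVK ?subrr // dotvv_eq0.
  have := stress_work p' y v; rewrite vp' mul0mx mxE => ->.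
  rewrite stress_work; apply/esym/eq_bigr => e _; congr (_ * _).
  set i := (enum_val e).1; set j := (enum_val e).2.
  have -> : p' i - p' j = (p i - p j) + ((i == k)%:R - (j == k)%:R) *: a.
    by rewrite /p' /bump scalerBl opprD addrACA.
  have ay : dot a (y i - y j) = 0 by rewrite dotDr dotNr !ya subrr.
  rewrite dotDl dotZl ay mulr0 addr0 /y opprD addrACA -opprD -scalerBl.
  by rewrite dotDr dotNr dotZr flat mulr0 subr0.
have := gen p'; rewrite leqNgt => /negP; apply.
have ltr : (kermx (rigidity_mx G p') < kermx (rigidity_mx G p))%MS.
  rewrite ltmxE; apply/andP; split.
    apply/row_subP => i; apply/sub_kermxP/stress_sub.
    by rewrite -row_mul mulmx_ker row0.
  apply: contra wp' => /(submx_trans _) sub.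
  by apply/eqP/sub_kermxP/sub/sub_kermxP.
have := rank_ltmx ltr; rewrite !mxrank_ker.
by rewrite ltn_sub2lE // rank_leq_row.
Qed.

(** Otherwise moving [v] alone along [a] is a motion; rigidity then gives
    [dot (p v - p j) a = 0] for every vertex [j], so everything is flat. *)
Lemma inf_rigid_nbhd_span G p v a :
    inf_rigid G p ->
    (forall b, (forall i j, dot (p i - p j) b = 0) -> b = 0) ->
    (forall j, G v j -> dot (p v - p j) a = 0) ->
  a = 0.
Proof.
move=> rigid span va; apply: span.
pose x i : 'rV[R]_d := (i == v)%:R *: a.
have mx : inf_motion G p x.
  move=> i j Gij; rewrite /x -scalerBl dotZr.
  have [eq_iv|_] := eqVneq i v; have [eq_jv|_] := eqVneq j v.
  - by rewrite subrr mul0r.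
  - by rewrite eq_iv va ?mulr0 // -eq_iv.
  - rewrite eq_jv -(opprB (p v) (p i)) dotNl va ?oppr0 ?mulr0 //.
    by rewrite adj_sym -eq_jv.
  - by rewrite subrr mul0r.
have pv j : dot (p v - p j) a = 0.
  have := inf_rigid_motion rigid mx v j; rewrite /x eqxx -scalerBl dotZr.
  have [->|_] := eqVneq j v; first by move=> _; rewrite subrr dot0l.
  by rewrite subr0 mul1r.
move=> i j; rewrite -(subrKA (p v)) -(opprB (p v) (p i)) dotDl dotNl !pv.
by rewrite oppr0 addr0.
Qed.

(** * Two bodies sharing a hinge *)

(** The bodies [V1 :|: U] and [V2 :|: U] are joined along [U] and by the bars
    [M].  The bounds on [#|U|] and [#|M|] provide a rotation about [U]
    compatible with [M], and those on [#|V1|] and [#|V2|] provide unmatched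
    vertices, whose neighbourhoods show that each body spans the space.  The
    clique [C] serves to exclude flat frameworks. *)
Lemma hinged_bodies_flexible G p (V1 V2 U C : {set 'I_n})
    (M : {set 'I_n * 'I_n}) :
    generic G p ->
    [disjoint V1 & V2] -> [disjoint V1 & U] -> [disjoint V2 & U] ->
    M \subset setX V1 V2 ->
    (forall i j, G i j ->
       [|| (i \in V1 :|: U) && (j \in V1 :|: U),
           (i \in V2 :|: U) && (j \in V2 :|: U), (i, j) \in M | (j, i) \in M]) ->
    {in C &, forall i j, i != j -> G i j} -> (d < #|C|)%N ->
    (#|M| < #|V1|)%N -> (#|M| < #|V2|)%N ->
    (0 < #|U| < d)%N -> (#|U| + #|M| <= d)%N ->
    M = set0 \/ (#|U| + 1 < d)%N ->
  inf_flexible G p.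
Proof.
move=> gen d12 d1U d2U sM hG clique ltdC ltM1 ltM2 /andP[U_gt0 ltUd] leUMd U1 rigid.
have not_flat b : (forall i j, dot (p i - p j) b = 0) -> b = 0.
  exact: generic_not_flat gen ltdC clique.
have [u0 u0U] := card_gt0P U_gt0.
pose y i := p i - p u0.
have yB i j : p i - p j = y i - y j by rewrite /y opprB addrA subrK.
have unmatched (V : {set 'I_n}) f : (#|M| < #|V|)%N ->
    exists2 v, v \in V & forall e : 'I_n * 'I_n, e \in M -> f e != v.
  move=> ltMV; have : ~~ (V \subset f @: M).
    apply: contraTN (ltMV) => /subset_leq_card le; rewrite -leqNgt.
    exact: leq_trans le (leq_imset_card _ _).
  case/subsetPn=> v vV vM; exists v => // e eM; apply: contraNneq vM => <-.
  exact: imset_f.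
have MP i j : (i, j) \in M -> i \in V1 /\ j \in V2.
  by move/(subsetP sM); rewrite inE => /andP[].
have span1 b : (forall i, i \in V1 :|: U -> dot (y i) b = 0) -> b = 0.
  move=> yb; have [v vV1 vM] := unmatched V1 fst ltM1.
  apply: (inf_rigid_nbhd_span (v := v) rigid not_flat) => j /hG/or4P[].
  - by case/andP=> hi hj; rewrite yB dotDl dotNl !yb // subr0.
  - by rewrite inE (disjointFr d12 vV1) (disjointFr d1U vV1).
  - by move/vM; rewrite eqxx.
  - by case/MP => _; rewrite (disjointFr d12 vV1).
have span2 b : (forall i, i \in V2 :|: U -> dot (y i) b = 0) -> b = 0.
  move=> yb; have [v vV2 vM] := unmatched V2 snd ltM2.
  apply: (inf_rigid_nbhd_span (v := v) rigid not_flat) => j /hG/or4P[].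
  - by rewrite inE (disjointFl d12 vV2) (disjointFr d2U vV2).
  - by case/andP=> hi hj; rewrite yB dotDl dotNl !yb // subr0.
  - by case/MP; rewrite (disjointFl d12 vV2).
  - by move/vM; rewrite eqxx.
have cardU : #|U :\ u0|.+1 = #|U| by rewrite (cardsD1 u0 U) u0U.
have [|||a [c [[a0 c0 ac] aU cU acM]]] := @exists_hinge_rotation _ _
    [seq y u | u <- enum (U :\ u0)] [seq (y e.1, y e.2) | e <- enum M].
- by rewrite !size_map -!cardE -addSn cardU.
- by rewrite size_map -cardE addn1 cardU.
- rewrite size_map -cardE addn2 cardU -(addn1 #|U|).
  by case: U1 => [->|]; [left; rewrite enum_set0 | right].
(* Only [#|U| - 1] conditions were imposed for the hinge, as [y u0 = 0]. *)
have vanish b : (forall v, v \in [seq y u | u <- enum (U :\ u0)] -> dot b v = 0) ->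
    forall u, u \in U -> dot (y u) b = 0.
  move=> bU u uU; have [->|neq_u] := eqVneq u u0.
    by rewrite /y subrr dot0l.
  by rewrite dotC bU // map_f // mem_enum !inE neq_u.
have {aU}aU := vanish a aU; have {cU vanish}cU := vanish c cU.
pose turn i := dot (y i) a *: c - dot (y i) c *: a.
have turnU u : u \in U -> turn u = 0.
  by move=> uU; rewrite /turn aU // cU // !scale0r subr0.
have turn_self i : dot (y i) (turn i) = 0.
  by rewrite /turn !dotE; ring.
(* [turn] comes from a skew-symmetric linear map applied to [y], so it is a
   motion of the complete graph. *)
have turn_rigid i j : dot (y i - y j) (turn i - turn j) = 0.
  by rewrite /turn !dotE; ring.
have turnM i j : (i, j) \in M -> dot (y i) (turn j) = 0.
  move=> ijM; have := acM (y i, y j).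
  rewrite (map_f (fun e => (y e.1, y e.2)) (x := (i, j))) ?mem_enum //=.
  move=> /(_ isT) e; rewrite /turn dotDr dotNr !dotZr.
  by rewrite ![dot (y _) _]dotC [dot c (y j) * _]mulrC e mulrC subrr.
pose x i := if i \in V2 then turn i else 0.
have x1 i : i \in V1 :|: U -> x i = 0.
  rewrite inE /x; case/orP=> h; last by rewrite (disjointFl d2U h).
  by rewrite (disjointFr d12 h).
have x2 i : i \in V2 :|: U -> x i = turn i.
  rewrite inE /x; case/orP=> [->//|h].
  by rewrite (disjointFl d2U h) turnU.
have mx : inf_motion G p x.
  move=> i j /hG/or4P[].
  - by case/andP=> /x1-> /x1->; rewrite subrr dot0r.
  - by case/andP=> /x2-> /x2->; rewrite yB.
  - move=> ijM; have [i1 j2] := MP _ _ ijM.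
    rewrite x1 ?x2 ?inE ?i1 ?j2 // yB sub0r dotNr dotDl dotNl turn_self.
    by rewrite turnM // subrr oppr0.
  - move=> ijM; have [j1 i2] := MP _ _ ijM.
    rewrite (x1 j) ?x2 ?inE ?j1 ?i2 // yB subr0 dotDl dotNl turn_self.
    by rewrite turnM // subrr.
(* Rigidity compares [V2] with [V1 :|: U], so [turn i] is orthogonal to a
   spanning set. *)
have turn0 i : i \in V2 -> turn i = 0.
  move=> i2; apply: span1 => j j1.
  have := inf_rigid_motion rigid mx j i; rewrite (x1 j) // x2 ?inE ?i2 //.
  rewrite yB sub0r dotNr dotDl dotNl turn_self oppr0 addr0.
  by move/eqP; rewrite oppr_eq0 => /eqP.
have /eqP := a0; apply; apply: span2 => i; rewrite inE => /orP[i2|/aU //].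
have /eqP := congr1 (dot c) (turn0 i i2).
rewrite /turn dotDr dotNr !dotZr dot0r (dotC c a) ac mulr0 subr0.
by rewrite mulf_eq0 dotvv_eq0 (negPf c0) orbF => /eqP.
Qed.
End Framework.

(** * Hyperbananas *)

Theorem theorem15 (R : realType) (b d n : nat) (G : sgraph n) :
  (2 <= b)%N ->
  (d = (2 * b - 1)%N /\ is_hyperbanana d b G) \/
  (d = (2 * b)%N /\ is_even_hyperbanana d b G) ->
  generically_flexible R d G.
Proof.
move=> b_ge2 hyp p gen.
(* Both kinds of graph are two bodies with hinge [U], with [M] empty in the
   first case. *)
have [V1 [V2 [U [M [parts sM GE dE]]]]] : exists (V1 V2 U : {set 'I_n}) (M : {set 'I_n * 'I_n}),
    [/\ hyperbanana_parts d b V1 V2 U, M \subset setX V1 V2,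
        forall x y, G x y =
          [|| hyperbanana_rel V1 V2 U x y, (x, y) \in M | (y, x) \in M]
      & M = set0 /\ d = (2 * b - 1)%N \/ #|M| = b /\ d = (2 * b)%N].
  case: hyp => [[dE [V1 [V2 [U [parts GE]]]]]
               | [dE [_ [V1 [V2 [U [M [parts [sM _ _] cM GE]]]]]]]].
    exists V1, V2, U, set0; split; rewrite ?sub0set //; last by left.
    by move=> x y; rewrite GE !inE !orbF.
  exists V1, V2, U, M; split=> //; right; split=> //.
  by rewrite cM dE mul2n doubleK.
have [_ [d12 d1U d2U] [c1 c2 cU]] := parts.
have [u uU] : exists u, u \in U by apply/card_gt0P; rewrite cU ltnW.
(* [V2] is a clique on [d] vertices; a banana vertex makes it large enough. *)
apply: (@hinged_bodies_flexible _ _ _ _ _ V1 V2 U (u |: V2) M) => //.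
- move=> i j; rewrite GE /hyperbanana_rel !inE.
  by do ![case: (_ \in _)]; rewrite ?andbT ?andbF ?orbT ?orbF.
- move=> i j; rewrite !inE GE /hyperbanana_rel !inE => hi hj neq_ij.
  rewrite neq_ij /=; case/predU1P: hi neq_ij => [->|->]; last first.
    by case/predU1P: hj => [->|->]; rewrite ?uU ?orbT.
  by case/predU1P: hj => [->|->]; rewrite ?eqxx // uU !orbT.
- by rewrite cardsU1 (disjointFl d2U uU) c2.
- by rewrite c1; case: dE => -[cM ->]; rewrite ?cM ?cards0; lia.
- by rewrite c2; case: dE => -[cM ->]; rewrite ?cM ?cards0; lia.
- by rewrite cU; case: dE => -[_ ->]; lia.
- by rewrite cU; case: dE => -[-> ->]; rewrite ?cards0; lia.
- by case: dE => -[cM dE]; [left | right; rewrite cU dE; lia].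
Qed.
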